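(* Let $X=\mathcal{D}^{\mathbb{Z}}$ be a Bernoulli shift on a finite alphabet $\mathcal{D}$, let $T$ be the left shift, and let $\mu$ be the associated Bernoulli measure on the Borel $\sigma$-algebra $\mathcal{B}$ of $X$. Endow $X$ with the generator $\mathcal{E}=\{E_d\}_{d\in\mathcal{D}}$, where $E_d=\{x\in X:x_0=d\}$. Consider the countably infinite product probability space $(X^\infty,\mathcal{B}^\infty,\mu^\infty)=\prod_{k\in\mathbb{N}}(X,\mathcal{B},\mu)$. Then the set of all $(x_k)_{k=1}^\infty\in X^\infty$ such that $$\alpha_{C_k(x_k)}\left(\frac1k\sum_{i=0}^{k-1}T^i f\right)\;\xrightarrow{k\to\infty}\;\int f\,\mathrm{d}\mu\quad\text{for all } f\in C(X)$$ is of full $\mu^\infty$-measure.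
   Context: The left shift is $(Tx)_n=x_{n+1}$, and $T^if=f\circ T^i$. The Bernoulli measure $\mu$ is the product measure on $\mathcal{D}^{\mathbb{Z}}$ induced by a probability vector $\mathbf{p}=(p(d))_{d\in\mathcal{D}}$. $C(X)$ is the space of complex-valued continuous functions. $C_k(x)=\bigcap_{i=0}^{k-1}T^{-i}E_{x_i}=\{y\in X:y_j=x_j\text{ for }0\le j\le k-1\}$. For measurable $F$ with $\mu(F)>0$, $\alpha_F(f)=\frac1{\mu(F)}\int_Ff\,\mathrm{d}\mu$. For $\mu^\infty$-almost every sequence $(x_k)$, $\mu(C_k(x_k))>0$ for all $k$, so the expressions are defined almost surely. *)

(* Defs.v *)
From HB Require Import structures.
From mathcomp Require Import all_boot all_order all_algebra.
From mathcomp Require Import all_classical all_reals all_analysis.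
From mathcomp Require Import finmap complex.

Set Implicit Arguments.
Unset Strict Implicit.
Unset Printing Implicit Defensive.

Import Order.TTheory GRing.Theory Num.Theory numFieldNormedType.Exports.

Local Open Scope classical_set_scope.
Local Open Scope ring_scope.

(* Alphabets. Measurable types are pointed in the library, and an alphabet that
   carries a probability vector is nonempty anyway. *)
#[short(type="alphabetType")]
HB.structure Definition Alphabet := {D of Finite D & Pointed D}.

Definition probability_vector (R : realType) (D : finType) (p : D -> R) :=
  (forall d, 0 <= p d) /\ \sum_d p d = 1.

(* [P] is the product, over the index set [I], of copies of the measure [m]
   defined on the sigma-algebra [G] of [T]: on every finite-dimensional
   measurable rectangle, [P] is the product of the masses of the sides. On the
   product sigma-algebra this determines the probability measure [P]. *)
Definition is_product_measure (R : realType) (I : choiceType) (T : Type)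
    (G : set (set T)) (m : set T -> \bar R) (P : set (I -> T) -> \bar R) :=
  forall (J : {fset I}) (A : I -> set T), (forall i, G (A i)) ->
    P [set x | forall i, i \in J -> A i (x i)] = (\prod_(i <- J) m (A i))%E.

Definition full_shift (D : Type) : Type := {ptws int -> discrete_topology D}.

Section full_shift_structures.
Variable D : alphabetType.

HB.instance Definition _ := Pointed.copy (full_shift D)
  {ptws int -> discrete_topology D}.
HB.instance Definition _ := Topological.copy (full_shift D)
  {ptws int -> discrete_topology D}.
(* the Borel sigma-algebra *)
HB.instance Definition _ := Measurable.copy (full_shift D)
  (g_sigma_algebraType (@open (full_shift D))).

End full_shift_structures.

Section full_shift_theory.
Context {R : realType} {D : alphabetType}.
Local Notation X := (full_shift D).
Implicit Types (x : X) (F : set X) (mu : set X -> \bar R) (f : X -> R[i]).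

Definition left_shift x : X := fun n : int => x (n + 1).

(* All subsets of the finite alphabet are measurable. *)
Definition is_bernoulli_measure (p : D -> R) mu :=
  is_product_measure (@setT (set D))
    (fun A : set D => (\sum_(d | d \in A) p d)%:E) mu.

Definition generator (d : D) : set X := [set x | x 0 = d].

Definition cylinder (k : nat) x : set X :=
  \bigcap_(i < k) (iter i left_shift @^-1` generator (x i%:Z)).

Definition complex_integral (mu : {measure set X -> \bar R}) F f : R[i] :=
  Complex (\int[mu]_(x in F) complex.Re (f x))
          (\int[mu]_(x in F) complex.Im (f x)).

Definition alpha (mu : {measure set X -> \bar R}) F f : R[i] :=
  ((fine (mu F))^-1)%:C%C * complex_integral mu F f.

Definition ergodic_average (k : nat) f : X -> R[i] :=
  fun x => k%:R^-1 * \sum_(i < k) f (iter i left_shift x).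

End full_shift_theory.

(* The countable power of a measurable space: the sigma-algebra is generated by
   the coordinate projections. *)
Definition coordinate_sets d (T : measurableType d) : set (set (nat -> T)) :=
  [set C | exists k, exists2 B : set T,
    measurable B & C = (fun x : nat -> T => x k) @^-1` B].

Definition countable_power d (T : measurableType d) : Type :=
  g_sigma_algebraType (@coordinate_sets d T).

HB.instance Definition _ d (T : measurableType d) :=
  Measurable.copy (countable_power T)
    (g_sigma_algebraType (@coordinate_sets d T)).

(* Main.v *)
(* On the cylinder C_k(x), every continuous f satisfies
   f(T^i y) = f(T^i x) + o(1) uniformly for indices i away from 0 and k, so that
   the mean of the ergodic average over C_k(x) is, up to an error tending to 0
   uniformly in x, the ergodic average of f at the single point x.  It remains to
   prove that these averages at x_k tend to the integral almost surely; by
   compactness it is enough to treat the countably many indicators of cylinders.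
   Since the points x_k change with k, the ergodic theorem does not apply: one
   needs a summable bound on the probability of a deviation, for Borel-Cantelli.
   The frequency of a word d v exceeds p(d) times that of v by 1/k times the sum
   of (1_{x_i = d} - p(d)) 1_{v occurs at i + 1}, a reversed martingale whose
   fourth moment is at most 4 k^2; an induction on the length of the word
   concludes. *)

Require Import Defs.
From HB Require Import structures.
From mathcomp Require Import all_boot all_order all_algebra.
From mathcomp Require Import all_classical all_reals all_analysis.
From mathcomp Require Import finmap complex.
From mathcomp Require Import zify ring lra.

Set Implicit Arguments.
Unset Strict Implicit.
Unset Printing Implicit Defensive.

Import Order.TTheory GRing.Theory Num.Theory numFieldNormedType.Exports.

Local Open Scope classical_set_scope.
Local Open Scope ring_scope.

(** * Words of independent letters *)

Section word_expectation.
Context {R : realFieldType} {D : finType} (p : D -> R).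
Hypothesis p_ge0 : forall d, 0 <= p d.
Hypothesis p_sum1 : \sum_d p d = 1.
Implicit Types F G : seq D -> R.

(** The expectation over [n] independent letters of law [p], as an iterated finite sum: the moment
    bounds need no measure theory, and the recursion separates the first letter from the rest. *)
Fixpoint word_expectation (n : nat) (F : seq D -> R) : R :=
  if n is n'.+1 then \sum_d p d * word_expectation n' (fun s => F (d :: s))
  else F [::].
Local Notation E := word_expectation.

Lemma le_word_expectation n F G :
  (forall s, size s = n -> F s <= G s) -> E n F <= E n G.
Proof.
elim: n F G => [|n IH] F G FG /=; first exact: FG.
apply: ler_sum => d _; apply: ler_wpM2l => //.
by apply: IH => s sn; apply: FG; rewrite /= sn.
Qed.

Lemma eq_word_expectation n F G :
  (forall s, size s = n -> F s = G s) -> E n F = E n G.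
Proof. by move=> FG; apply/le_anti/andP; split; apply: le_word_expectation => s /FG ->. Qed.

Lemma word_expectationD n F G : E n (fun s => F s + G s) = E n F + E n G.
Proof.
elim: n F G => //= n IH F G; rewrite -big_split/=.
by apply: eq_bigr => d _; rewrite -mulrDr -IH.
Qed.

Lemma word_expectationZ n c F : E n (fun s => c * F s) = c * E n F.
Proof.
elim: n F => //= n IH F; rewrite mulr_sumr; apply: eq_bigr => d _.
by rewrite (IH (fun s => F (d :: s))) mulrCA.
Qed.

Lemma word_expectation_cst n c : E n (fun=> c) = c.
Proof.
elim: n => //= n IH; rewrite (eq_bigr (fun d => p d * c)) => [|d _].
  by rewrite -mulr_suml p_sum1 mul1r.
by rewrite IH.
Qed.

Lemma word_expectation_markov n F c : 0 < c -> (forall s, 0 <= F s) ->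
  E n (fun s => (c <= F s)%R%:R) <= E n F / c.
Proof.
move=> c0 F0; rewrite mulrC -word_expectationZ; apply: le_word_expectation => s _.
case: (lerP c (F s)) => [cF|_]; last by rewrite mulr_ge0// invr_ge0 ltW.
by rewrite mulrC ler_pdivlMr// mul1r.
Qed.

(** With [q = 1]: a random word almost surely avoids letters of probability 0. The factor [q]
    collects the letters already read, which keeps the induction going. *)
Lemma word_expectation_null n (q : R) :
  E n (fun s => (q * \prod_(d <- s) p d == 0)%R%:R) = (q == 0)%:R.
Proof.
elim: n q => [|n IH] q /=; first by rewrite big_nil mulr1.
transitivity (\sum_d p d * (q == 0)%:R); last by rewrite -mulr_suml p_sum1 mul1r.
apply: eq_bigr => d _.
rewrite (@eq_word_expectation _ _ (fun s => (q * p d * \prod_(c <- s) p c == 0)%R%:R)).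
  rewrite IH mulf_eq0; have [->|_] := eqVneq (p d) 0; first by rewrite !mul0r.
  by rewrite orbF.
by move=> s _; rewrite big_cons mulrA.
Qed.

(* Reading the word from right to left, the terms of this sum are martingale
   differences as soon as xi has mean 0. *)
Fixpoint mart_sum (xi : D -> R) (h : seq D -> R) (k : nat) (s : seq D) : R :=
  if k is k'.+1 then
    if s is d :: s' then xi d * h s' + mart_sum xi h k' s' else 0
  else 0.

(** * Moments of the martingale sums *)

Section moments.
Variables (xi : D -> R) (h : seq D -> R).
Hypothesis xi_mean : \sum_d p d * xi d = 0.
Hypothesis xi_le1 : forall d, `|xi d| <= 1.
Hypothesis h_le1 : forall s, `|h s| <= 1.
Local Notation M := (mart_sum xi h).

(** Induction on [k]: in the square of [xi d * h s + M k s] the cross term is [xi d] times a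
    function of the later letters, so it averages to 0. The [L] extra letters leave room for [h] to
    look beyond the summed positions. *)
Lemma mart_sum_moment2 k L : E (k + L) (fun s => M k s ^+ 2) <= k%:R.
Proof.
elim: k => [|k IH].
  rewrite (_ : (fun s => _) = fun=> 0) ?word_expectation_cst//.
  by apply/funext => s; rewrite expr0n.
rewrite addSn /=.
have step d : p d * E (k + L) (fun s => (xi d * h s + M k s) ^+ 2) <=
    p d * (1 + E (k + L) (fun s => M k s ^+ 2)) +
    (p d * xi d) * E (k + L) (fun s => 2 * h s * M k s).
  rewrite -mulrA -mulrDr; apply: ler_wpM2l => //; rewrite -word_expectationZ.
  rewrite -[X in X + E _ _ + _](word_expectation_cst (k + L)) -!word_expectationD.
  apply: le_word_expectation => s _.
  have : `|xi d * h s| <= 1 by rewrite normrM mulr_ile1.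
  rewrite ler_norml => /andP[a1 a2].
  rewrite (_ : xi d * (2 * h s * M k s) = 2 * (xi d * h s) * M k s); last by ring.
  by move: (xi d * h s) (M k s) a1 a2 => a m; nra.
apply: (le_trans (ler_sum _ (fun d _ => step d))).
rewrite big_split/= -!mulr_suml p_sum1 xi_mean mul0r addr0 mul1r -natr1 addrC.
by rewrite lerD2r.
Qed.

(** In the fourth power the term linear in [xi d] averages to 0, and the cubic one is absorbed by
    the even ones. What remains gives an increment of at most [3 + 8 * k], below
    [4 * (k + 1) ^ 2 - 4 * k ^ 2]. *)
Lemma mart_sum_moment4 k L : E (k + L) (fun s => M k s ^+ 4) <= 4 * k%:R ^+ 2.
Proof.
elim: k => [|k IH].
  rewrite (_ : (fun s => _) = fun=> 0) ?word_expectation_cst ?expr0n ?mulr0//.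
  by apply/funext => s; rewrite expr0n.
rewrite addSn /=.
(* With [a = xi d * h s] and [m = M k s], the cubic term is at most [2 * a ^ 4 + 2 * a ^ 2 * m ^ 2],
   whence 3 = 1 + 2 and 8 = 6 + 2. *)
have step d : p d * E (k + L) (fun s => (xi d * h s + M k s) ^+ 4) <=
    p d * (3 + 8 * E (k + L) (fun s => M k s ^+ 2) +
           E (k + L) (fun s => M k s ^+ 4)) +
    (p d * xi d) * E (k + L) (fun s => 4 * h s * M k s ^+ 3).
  rewrite -mulrA -mulrDr; apply: ler_wpM2l => //; rewrite -!word_expectationZ.
  rewrite -[X in X + E _ _ + _ + _](word_expectation_cst (k + L)) -!word_expectationD.
  apply: le_word_expectation => s _.
  have : `|xi d * h s| <= 1 by rewrite normrM mulr_ile1.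
  set a := xi d * h s; set m := M k s; rewrite ler_norml => /andP[a1 a2].
  have a2_le1 : a ^+ 2 <= 1 by nra.
  have a2_ge0 : 0 <= a ^+ 2 by rewrite sqr_ge0.
  have m2_ge0 : 0 <= m ^+ 2 by rewrite sqr_ge0.
  have h1 : 4 * (a ^+ 3 * m) <= 2 * (a ^+ 2 * (a ^+ 2 + m ^+ 2)).
    by have := mulr_ge0 a2_ge0 (sqr_ge0 (a - m)); nra.
  have h2 : (a + m) ^+ 4 = a ^+ 4 + 4 * (a ^+ 3 * m) + 6 * (a ^+ 2 * m ^+ 2) +
    4 * h s * m ^+ 3 * xi d + m ^+ 4 by rewrite /a; ring.
  have h3 : a ^+ 4 <= 1 by rewrite (exprM a 2 2) exprn_ile1.
  have h4 : a ^+ 2 * m ^+ 2 <= m ^+ 2 by rewrite ler_piMl.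
  rewrite h2 (_ : xi d * (4 * h s * m ^+ 3) = 4 * h s * m ^+ 3 * xi d); last by ring.
  have h5 : a ^+ 2 * (a ^+ 2 + m ^+ 2) = a ^+ 4 + a ^+ 2 * m ^+ 2 by ring.
  by move: h1; rewrite h5; lra.
apply: (le_trans (ler_sum _ (fun d _ => step d))).
rewrite big_split/= -!mulr_suml p_sum1 xi_mean mul0r addr0 mul1r -natr1.
have := mart_sum_moment2 k L; have := ler0n R k; nra.
Qed.

End moments.
End word_expectation.

(** * Words read in the full shift *)

Section words.
Context {D : alphabetType}.
Local Notation X := (full_shift D).
Implicit Types (y z : X) (a : int).

Fixpoint word (a : int) (n : nat) (y : X) : seq D :=
  if n is n'.+1 then (y a : D) :: word (a + 1) n' y else [::].

Lemma size_word a n y : size (word a n y) = n.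
Proof. by elim: n a => //= n IH a; rewrite IH. Qed.

Lemma word_cat a m n y : word a (m + n) y = word a m y ++ word (a + m%:Z) n y.
Proof.
elim: m a => [|m IH] a /=; first by rewrite addr0.
by rewrite IH -addrA -intS.
Qed.

Lemma eq_word a n y z :
  (forall j : int, a <= j < a + n%:Z -> y j = z j) -> word a n y = word a n z.
Proof.
elim: n a => //= n IH a yz; congr (_ :: _); first by apply: yz; lia.
by apply: IH => j ?; apply: yz; lia.
Qed.

Lemma word_inj a n y z : word a n y = word a n z ->
  forall j : int, a <= j < a + n%:Z -> y j = z j.
Proof.
elim: n a => [|n IH] a /=; first by move=> _ j; lia.
move=> [ya yz] j; have [->//|ja] := eqVneq j a.
by move=> ?; apply: (IH _ yz); lia.
Qed.

Lemma iter_left_shift i y (j : int) : iter i left_shift y j = y (j + i%:Z).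
Proof.
elim: i j => [|i IH] j /=; first by rewrite addr0.
by rewrite /left_shift /= IH -addrA -intS.
Qed.

Lemma word_iter_shift a n i y : word a n (iter i left_shift y) = word (a + i%:Z) n y.
Proof.
elim: n a => //= n IH a; rewrite IH iter_left_shift.
by congr (_ :: word _ _ _); lia.
Qed.

Lemma open_letter a (A : set D) : open [set y : X | A (y a)].
Proof.
apply: (@open_comp X (discrete_topology D) (fun y => y a)).
  by move=> y _; exact: (@proj_continuous int (fun=> discrete_topology D) a y).
exact: discrete_open.
Qed.

Lemma open_word a n (B : set (seq D)) : open [set y : X | B (word a n y)].
Proof.
elim: n a B => [|n IH] a B /=.
  have [b|b] := pselect (B [::]).
    by rewrite (_ : mkset _ = setT); [exact: openT|apply/seteqP; split].
  by rewrite (_ : mkset _ = set0); [exact: open0|apply/seteqP; split].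
rewrite (_ : [set _ | _] = \bigcup_(d in [set: D])
    ([set y : X | [set d] (y a)] `&` [set y : X | [set s | B (d :: s)] (word (a + 1) n y)])).
  by apply: bigcup_open => d _; apply: openI; [exact: open_letter|exact: IH].
apply/seteqP; split => y /=; first by exists (y a).
by move=> [d _ [/= -> ]].
Qed.

Lemma measurable_word a n (B : set (seq D)) :
  measurable [set y : X | B (word a n y)].
Proof. by apply: sub_sigma_algebra; exact: open_word. Qed.

Lemma nbhs_word a n y : nbhs y [set z | word a n z = word a n y].
Proof.
apply: open_nbhs_nbhs; split => //.
exact: (@open_word a n [set word a n y]).
Qed.

Lemma compact_full_shift : compact [set: X].
Proof.
have cD : compact [set: discrete_topology D].
  by apply: finite_compact; exact: (@finite_finset D).
have := @tychonoff int (fun=> discrete_topology D) (fun=> setT) (fun=> cD).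
by congr (@compact X _); apply/seteqP.
Qed.

End words.

(** * The Bernoulli measure of word events *)

Section words_measure.
Context {R : realType} {D : alphabetType} (p : D -> R).
Local Notation X := (full_shift D).
Variable mu : probability X R.
Hypothesis mu_bernoulli : is_bernoulli_measure p mu.

(** The rectangle over coordinates left of [a] is there for the induction on [n]: the first letter
    of the word is fixed and moved into the rectangle, until only the product formula for rectangles
    is left to apply. *)
Lemma mu_rectangle_word (J : {fset int}) (A : int -> set D) a n (B : pred (seq D)) :
  (forall j, j \in J -> j < a) ->
  mu ([set y | forall i, i \in J -> A i (y i)] `&` [set y | B (word a n y)]) =
  ((\prod_(i <- J) \sum_(d | d \in A i) p d) *
   word_expectation p n (fun s => (B s)%:R))%:E.
Proof.
elim: n a J A B => [|n IH] a J A B Ja /=.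
  have [b|b] := boolP (B [::]).
    rewrite (_ : [set _ | is_true true] = setT) ?setIT ?mulr1; last exact/seteqP.
    by rewrite mu_bernoulli// prodEFin.
  rewrite (_ : [set _ | is_true false] = set0) ?setI0 ?measure0 ?mulr0//.
  by apply/seteqP; split.
have aJ : a \notin J by apply/negP => /Ja; rewrite ltxx.
pose J' := (a |` J)%fset.
pose A' d i := if i == a then [set d] else A i.
pose F d := [set y : X | forall i, i \in J' -> A' d i (y i)] `&`
  [set y | B (d :: word (a + 1) n y)].
have JA' d y : (forall i, i \in J' -> A' d i (y i)) <->
    (forall i, i \in J -> A i (y i)) /\ y a = d.
  split=> [H|[H1 H2] i].
    split=> [i iJ|]; last by have := H a; rewrite /A' eqxx; apply; rewrite fset1U1.
    have := H i; rewrite /A' in_fset1U iJ orbT => /(_ isT).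
    by case: eqP => // ia; rewrite ia (negbTE aJ) in iJ.
  rewrite /A' in_fset1U; case: eqP => [->//|_ /=]; exact: H1.
have mF d : measurable (F d).
  apply: measurableI; last exact: (@measurable_word _ _ _ [set s | B (d :: s)]).
  rewrite (_ : [set _ | _] = \bigcap_(i in [set` J']) [set y : X | A' d i (y i)]).
    apply: fin_bigcap_measurable => // i _.
    by apply: sub_sigma_algebra; exact: open_letter.
  by apply/seteqP; split.
(* Finite disjoint partition according to the letter at [a]. *)
rewrite (_ : _ `&` _ = \bigcup_(d in [set: D]) F d); last first.
  apply/seteqP; split => y /=.
    move=> [JA b]; exists (y a) => //; split=> //=; exact/JA'.
  by move=> [d _ [/= /JA'[? <-]]].
rewrite measure_fin_bigcup//; first last.
- by move=> d d' _ _ [y [[/= /JA'[_ <-] _] [/JA'[_ <-] _]]].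
- exact: finite_finset.
rewrite (_ : [set: D] = [set` index_enum D]); last first.
  by apply/seteqP; split => // d _; exact: mem_index_enum.
rewrite -fsbig_seq ?index_enum_uniq//= mulr_sumr -sumEFin.
apply: eq_bigr => d _; rewrite /F (IH (a + 1) J' (A' d) (fun s => B (d :: s))); last first.
  by move=> j; rewrite in_fset1U => /orP[/eqP->|/Ja]; lia.
congr EFin; rewrite mulrA; congr (_ * _).
rewrite big_fsetU1//= mulrC /A' eqxx; congr (_ * _); last first.
  by rewrite (big_pred1 d)// => c; rewrite classical_sets.in_set1.
rewrite big_seq [RHS]big_seq; apply: eq_bigr => i iJ.
by case: eqP => // ia; rewrite ia (negbTE aJ) in iJ.
Qed.

Lemma mu_word a n (B : pred (seq D)) :
  mu [set y | B (word a n y)] = (word_expectation p n (fun s => (B s)%:R))%:E.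
Proof.
have := @mu_rectangle_word fset0 (fun=> setT) a n B; rewrite big_seq_fset0 mul1r => <-//.
by congr (mu _); apply/seteqP; split=> // y [].
Qed.

End words_measure.

(** * Almost sure convergence of frequencies *)

Section borel_cantelli_power.
Context {R : realType} {d : measure_display} {T : measurableType d}.
Variables (mu : probability T R) (P : probability (countable_power T) R).
Hypothesis P_product : is_product_measure (@measurable _ T) mu P.

Lemma measurable_coordinate k (B : set T) :
  measurable B -> measurable [set x : countable_power T | B (x k)].
Proof. by move=> mB; apply: sub_sigma_algebra; exists k, B. Qed.

Lemma coordinate_measure k (B : set T) :
  measurable B -> P [set x | B (x k)] = mu B.
Proof.
move=> mB; have := P_product [fset k]%fset (fun=> mB).
rewrite big_seq_fset1 => <-; congr (P _); apply/seteqP; split=> x /=.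
  by move=> Bx i; rewrite inE => /eqP ->.
by move=> /(_ k); apply; rewrite inE.
Qed.

Lemma nneseries_inv_sqr_lty (u : nat -> \bar R) (c : R) : (forall k, 0 <= u k)%E ->
  (forall k, u k <= (c / k.+1%:R ^+ 2)%:E)%E -> (\sum_(k <oo) u k < +oo)%E.
Proof.
move=> u0 uc.
have c0 : 0 <= c.
  by have := le_trans (u0 0%N) (uc 0%N); rewrite expr1n divr1 lee_fin.
(* Telescoping bound: [1 / a ^ 2 <= 2 * (1 / a - 1 / (a + 1))] for [a >= 1]. *)
have partial n : (\sum_(0 <= k < n) u k <= (2 * c * (1 - n.+1%:R^-1))%:E)%E.
  elim: n => [|n IH]; first by rewrite big_nil invr1 subrr mulr0.
  rewrite big_nat_recr//=; apply: le_trans (leeD IH (uc n)) _.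
  rewrite -EFinD lee_fin -[n.+2%:R]natr1.
  have a1 : 1 <= n.+1%:R :> R by rewrite ler1n.
  move: (n.+1%:R : R) a1 => a a1; rewrite -subr_ge0.
  have -> : 2 * c * (1 - (a + 1)^-1) - (2 * c * (1 - a^-1) + c / a ^+ 2) =
      c * (a - 1) / (a ^+ 2 * (a + 1)) by field; lra.
  by rewrite divr_ge0 ?mulr_ge0//; nra.
apply: (@le_lt_trans _ _ (2 * c)%:E); last by rewrite ltry.
apply: lime_le; first exact: is_cvg_nneseries.
apply: nearW => n; apply: le_trans (partial n) _; rewrite lee_fin.
by rewrite ler_piMr ?mulr_ge0// gerBl invr_ge0.
Qed.

(** The deviation at index [k] involves only the coordinate [x k], so its [P]-measure is the
    [mu]-measure of a set in one factor. These measures are summable, and the first Borel-Cantelli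
    lemma applies to each threshold [e]. *)
Lemma ae_cvg0_power (h : nat -> T -> R) (c : R -> R) :
  (forall k (e : R), measurable [set y | e <= `|h k y|]) ->
  (forall k (e : R), 0 < e ->
    (mu [set y | (e <= `|h k y|)%R] <= (c e / k.+1%:R ^+ 2)%:E)%E) ->
  {ae P, forall x, (fun k => h k (x k)) @ \oo --> (0 : R)}.
Proof.
move=> mh hc.
pose F (e : R) k := [set x : countable_power T | e <= `|h k (x k)|].
have mF e k : measurable (F e k) by exact: (measurable_coordinate k (mh k e)).
have PF e : 0 < e -> P (lim_sup_set (F e)) = 0%E.
  move=> e0; apply: lim_sup_set_cvg0 => //.
  apply: (@nneseries_inv_sqr_lty _ (c e)) => // k.
  by have /= := coordinate_measure k (mh k e); rewrite /F => ->; exact: hc.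
(* Thresholds [1 / (m + 1)] suffice, so only countably many null sets are discarded. *)
have : {ae P, forall x, forall m : nat, ~ lim_sup_set (F m.+1%:R^-1) x}.
  apply: ae_foralln => m; exists (lim_sup_set (F m.+1%:R^-1)); split.
  - apply: bigcap_measurable => // n _.
    by apply: bigcup_measurable.
  - exact: PF.
  - by move=> x /= /notP.
apply: filterS => x nF; apply/cvgrPdist_lt => e e0.
have [m _ me] := near_infty_natSinv_lt (PosNum e0).
have /= := nF m; move=> /existsNP[n /not_implyP[_ nn]].
exists n => // k /= nk; rewrite sub0r normrN.
apply: lt_trans (me m (leqnn m)) => /=.
by rewrite ltNge; apply/negP => Fk; apply: nn; exists k.
Qed.

End borel_cantelli_power.

(** * Frequencies of words along the sequence of points *)

Section frequencies.
Context {R : realType} {D : alphabetType} (p : D -> R).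
Local Notation X := (full_shift D).
Hypothesis p_prob : probability_vector p.
Variable mu : probability X R.
Hypothesis mu_bernoulli : is_bernoulli_measure p mu.
Variable P : probability (countable_power X) R.
Hypothesis P_product : is_product_measure (@measurable _ X) mu P.

(** Markov's inequality for the fourth power: [4 * k ^ 2 / (e * k) ^ 4] is of order [1 / k ^ 2],
    hence summable; the second moment would give only [1 / k]. *)
Lemma mart_sum_ae_cvg0 xi h a L :
  \sum_d p d * xi d = 0 -> (forall d, `|xi d| <= 1) -> (forall s, `|h s| <= 1) ->
  {ae P, forall x, (fun k => k.+1%:R^-1 * mart_sum xi h k.+1 (word a (k.+1 + L) (x k)))
    @ \oo --> (0 : R)}.
Proof.
move=> xi0 xi1 h1; have [p0 p1] := p_prob.
apply: (ae_cvg0_power P_product (c := fun e => 4 / e ^+ 4)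
  (h := fun k y => k.+1%:R^-1 * mart_sum xi h k.+1 (word a (k.+1 + L) y))).
  move=> k e.
  exact: (@measurable_word _ a (k.+1 + L) [set s | e <= `|k.+1%:R^-1 * mart_sum xi h k.+1 s|]).
move=> k e e0.
rewrite (mu_word mu_bernoulli a (k.+1 + L)
  (fun s => e <= `|k.+1%:R^-1 * mart_sum xi h k.+1 s|)).
rewrite lee_fin.
pose c := (e * k.+1%:R) ^+ 4.
have c0 : 0 < c by rewrite exprn_gt0// mulr_gt0.
apply: (@le_trans _ _ (word_expectation p (k.+1 + L)
  (fun s => (c <= mart_sum xi h k.+1 s ^+ 4)%R%:R))).
  apply: le_word_expectation => // s _; rewrite ler_nat.
  case: (lerP e _) => //= he; rewrite lt0b.
  move: he; rewrite normrM ger0_norm// mulrC ler_pdivlMr// => he.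
  rewrite -[leRHS]ger0_norm ?exprn_even_ge0// normrX lerXn2r ?nnegrE ?mulr_ge0//.
  exact: ltW.
apply: le_trans (word_expectation_markov p0 _ _ _) _ => //.
  by move=> s; rewrite exprn_even_ge0.
rewrite ler_pdivrMr//; apply: le_trans (mart_sum_moment4 _ _ _ _ _ _ _) _ => //.
rewrite /c exprMn le_eqVlt; apply/orP; left; apply/eqP.
have := lt0r_neq0 e0; have : k.+1%:R != 0 :> R by [].
by move: (k.+1%:R : R) => b b0 e0'; field; rewrite b0 e0'.
Qed.

Definition frequency a (u : seq D) k (y : X) : R :=
  k%:R^-1 * \sum_(i < k) (word (a + i%:Z) (size u) y == u)%:R.

(** At each position the indicator of [d] is split into its centred part and its mean [p d]. Since
    [mart_sum] hands [h] the whole remaining word, [take] cuts out the letters to be compared with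
    [v]. *)
Lemma frequency_cons a d v k (y : X) :
  frequency a (d :: v) k y =
    k%:R^-1 * mart_sum (fun c => (c == d)%:R - p d)
       (fun s => (take (size v) s == v)%:R) k (word a (k + size v) y)
    + p d * frequency (a + 1) v k y.
Proof.
rewrite /frequency mulrCA -mulrDr; congr (_ * _).
elim: k a => [|k IH] a /=; first by rewrite !big_ord0 mulr0 addr0.
rewrite !big_ord_recl/= !addr0.
under eq_bigr do rewrite /bump/= add1n intS addrA.
under [in RHS]eq_bigr do rewrite /bump/= add1n intS addrA.
have /= -> := IH (a + 1).
have -> : take (size v) (word (a + 1) (k + size v) y) = word (a + 1) (size v) y.
  by rewrite addnC word_cat take_size_cat// size_word.
rewrite eqseq_cons -mulnb natrM; ring.
Qed.

(** Induction on the word: by [frequency_cons] a letter in front contributes the factor [p d] and an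
    error that tends to 0. All offsets [a] are treated at once, because the tail is read from
    [a + 1]. *)
Lemma frequency_ae_cvg a (u : seq D) :
  {ae P, forall x, (fun k => frequency a u k.+1 (x k)) @ \oo --> \prod_(d <- u) p d}.
Proof.
have [p0 p1] := p_prob.
elim: u a => [|d v IH] a.
  apply: aeW => x; rewrite big_nil.
  rewrite (_ : (fun k => _) = fun=> 1); first exact: cvg_cst.
  apply/funext => k; rewrite /frequency /= sumr_const card_ord -[_ *+ _]mulr_natl mulr1.
  by rewrite mulVf.
have pd1 : p d <= 1.
  by rewrite -p1 (bigD1 d)//= lerDl sumr_ge0.
have := @mart_sum_ae_cvg0 (fun c => (c == d)%:R - p d)
  (fun s => (take (size v) s == v)%:R) a (size v).
move=> /(_ _ _ _) M0.
have aeF := ae_filter_ringOfSetsType P.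
apply: (@filterS2 _ (almost_everywhere P) aeF _ _ _ _ (IH (a + 1)) (M0 _ _ _)).
- move=> x vx Mx; rewrite big_cons -[X in _ --> X]add0r.
  under eq_fun do rewrite frequency_cons.
  by apply: cvgD => //; apply: cvgMl_tmp.
- transitivity (p d - p d * \sum_c p c); last by rewrite p1 mulr1 subrr.
  under eq_bigr do rewrite mulrBr.
  rewrite sumrB; congr (_ - _); last first.
    by rewrite mulr_sumr; apply: eq_bigr => c _; rewrite mulrC.
  rewrite (bigD1 d)//= eqxx mulr1 big1 ?addr0// => c /negbTE ->.
  by rewrite mulr0.
- move=> c; rewrite ler_norml; have := p0 d.
  by case: (c == d) => /=; lra.
- by move=> s; case: (_ == _); rewrite ?normr1 ?normr0.
Qed.

End frequencies.

(** * Continuous functions on the full shift *)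

Section topology.
Context {D : alphabetType}.
Local Notation X := (full_shift D).

Lemma cvg_full_shift (F : set_system X) (FF : Filter F) (y : X) :
  (forall j : int, F [set z | z j = y j]) -> F --> y.
Proof.
move=> Fy; apply/(@pointwise_cvgP (discrete_topology int) (discrete_topology D)) => j.
by apply/(@discrete_cvg (discrete_topology D)); exact: Fy.
Qed.

Lemma continuous_left_shift : continuous (@left_shift D).
Proof.
move=> y.
have FF : Filter (fmap (@left_shift D) (nbhs (y : X))).
  exact: (@fmap_filter X X (@left_shift D) (nbhs y) (nbhs_filter y)).
apply: (@cvg_full_shift (fmap (@left_shift D) (nbhs (y : X))) FF (left_shift y)) => j.
have := nbhs_word (j + 1) 1 y.
by apply: (@filterS _ (nbhs y)) => z /= [].
Qed.

Lemma continuous_iter_shift i : continuous (iter i (@left_shift D)).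
Proof.
elim: i => [|i IH] y; first exact: cvg_id.
by apply: continuous_comp; [exact: IH|exact: continuous_left_shift].
Qed.

(** Such a function is locally constant, whatever [h] is. *)
Lemma continuous_word (T : topologicalType) a n (h : seq D -> T) :
  continuous (fun y : X => h (word a n y)).
Proof.
move=> y A /= /nbhs_singleton hy.
by have := nbhs_word a n y; apply: filterS => z /= ->.
Qed.

Definition window (n : nat) (y : X) : seq D := word (- n%:Z) (n + n.+1) y.

(** Uniform continuity from compactness, with agreement on a central window in the role of
    closeness. *)
Lemma continuous_window (R : realType) (g : X -> R) (e : R) : continuous g -> 0 < e ->
  exists n, forall y z, window n y = window n z -> `|g y - g z| <= e.
Proof.
move=> cg e0.
have wS m n y z : (m <= n)%N -> window n y = window n z -> window m y = window m z.
  by move=> mn /word_inj yz; apply: eq_word => j jm; apply: yz; lia.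
(* The window cylinders around [y] are a basis of the filter [W y], which converges to [y]; so every
   neighbourhood of [y] contains one of them. *)
pose W (y : X) : set_system X := fun A => exists n, [set z | window n z = window n y] `<=` A.
have FW y : Filter (W y).
  split; first by exists 0%N.
    move=> P Q [m mP] [n nQ]; exists (maxn m n) => z /= zy.
    by split; [apply: mP|apply: nQ]; apply: wS zy; rewrite ?leq_maxl ?leq_maxr.
  by move=> P Q PQ [n nP]; exists n => z /nP /PQ.
have Wy y : W y --> y.
  apply: cvg_full_shift => j; exists `|j|%N => z /= /word_inj; apply; lia.
(* Compactness as near-covering: what holds around each point for all large [n] holds at all points
   for a common [n]. *)
have := (compact_near_coveringP _).1 (@compact_full_shift D) nat \oo
  (fun n y => forall z, window n y = window n z -> `|g y - g z| <= e) _.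
move=> /(_ _)[y _|n _ nP]; last first.
  by exists n => y z; apply: (nP n) => //=.
have : nbhs y [set z | `|g y - g z| < e / 2].
  have /cvgrPdist_lt := cg y; apply; lra.
move=> /(Wy y) [n nU].
exists ([set z | window n z = window n y], [set m | (n <= m)%N]) => /=.
  by split; [exact: nbhs_word|exists n].
(* Both [y'] and [z] agree with [y] on the window of size [n], so each costs [e / 2]. *)
move=> [y' m] /= [yy' nm] z y'z.
have zy : window n z = window n y by rewrite -yy'; apply/esym; apply: wS y'z.
have := nU _ zy; have /= := nU _ yy'; rewrite /=.
rewrite (distrC (g y) (g y')) => h1 h2.
rewrite (_ : g y' - g z = (g y' - g y) + (g y - g z)); last by ring.
by rewrite (le_trans (ler_normD _ _))//; lra.
Qed.

Lemma continuous_bounded (R : realType) (g : X -> R) : continuous g ->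
  exists M, forall y, `|g y| <= M.
Proof.
move=> cg; have : compact (g @` setT).
  by apply: continuous_compact => //; [exact: continuous_subspaceT|exact: compact_full_shift].
move=> /compact_bounded[M [_ gM]]; exists (M + 1) => y.
by apply: (gM (M + 1)); [rewrite ltrDl|exists y].
Qed.

Lemma continuous_measurable (R : realType) (g : X -> R) :
  continuous g -> measurable_fun setT g.
Proof.
move=> /continuousP cg; apply: (measurability _ (measurable_realfun.RGenOpens.measurableE R)).
move=> _ [_ [a [b ->]] <-]; rewrite setTI; apply: sub_sigma_algebra.
by apply: cg; exact: interval_open.
Qed.

End topology.

(** * Integrals of continuous functions *)

Section integrals.
Context {R : realType} {D : alphabetType}.
Local Notation X := (full_shift D).
Variable mu : probability X R.

Lemma continuous_integrable (g : X -> R) F : measurable F -> continuous g ->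
  mu.-integrable F (EFin \o g).
Proof.
move=> mF cg; apply: (@integrableS _ _ _ _ setT) => //.
apply: measurable_bounded_integrable => //.
- apply: le_lt_trans (@probability_le1 _ _ _ mu setT _) _ => //; exact: ltry.
- exact: continuous_measurable.
- have [M gM] := continuous_bounded cg; exists M; split; first exact: num_real.
  by move=> x Mx y _; apply: le_trans (gM y) (ltW Mx).
Qed.

Lemma mean_near (g : X -> R) F (c e : R) : measurable F -> (0 < mu F)%E -> continuous g ->
  (forall y, F y -> `|g y - c| <= e) ->
  `|(fine (mu F))^-1 * \int[mu]_(y in F) g y - c| <= e.
Proof.
move=> mF F0 cg gc.
have Ffin : mu F \is a fin_num by exact: fin_num_measure.
have m0 : 0 < fine (mu F) by rewrite -lte_fin fineK.
have ig := continuous_integrable mF cg.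
have ic r : mu.-integrable F (EFin \o cst r).
  apply: (continuous_integrable (g := cst r)) => //.
  exact: cst_continuous.
have lo : \int[mu]_(y in F) (c - e) <= \int[mu]_(y in F) g y.
  by apply: (le_Rintegral mF (ic _) ig) => y /gc; rewrite ler_norml => /andP[h1 h2];
    have : c - e <= g y by lra.
have hi : \int[mu]_(y in F) g y <= \int[mu]_(y in F) (c + e).
  by apply: (le_Rintegral mF ig (ic _)) => y /gc; rewrite ler_norml => /andP[h1 h2];
    have : g y <= c + e by lra.
rewrite !Rintegral_cst// in lo hi.
rewrite -(ler_pdivlMr _ _ m0) in lo; rewrite -(ler_pdivrMr _ _ m0) in hi.
by rewrite mulrC ler_norml; apply/andP; split; lra.
Qed.

Lemma Rintegral_sum (I : Type) (r : seq I) (g : I -> X -> R) :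
  (forall i, continuous (g i)) ->
  \int[mu]_y (\sum_(i <- r) g i y) = \sum_(i <- r) \int[mu]_y g i y.
Proof.
move=> cg; elim: r => [|i r IH].
  rewrite big_nil; under eq_Rintegral do rewrite big_nil.
  by rewrite Rintegral_cst// mul0r.
rewrite big_cons -IH; under eq_Rintegral do rewrite big_cons.
apply: RintegralD => //; apply: continuous_integrable => //.
by apply: continuous_big => [|j _]; [exact: add_continuous|exact: cg].
Qed.

End integrals.

(** * Real and imaginary parts in limits *)

Section complex_convergence.
Context {R : realType}.
Implicit Types z : R[i].

(** Multiplication by [i] turns the imaginary part into a real part, up to sign, and keeps the
    modulus. *)
Lemma normc_ge_Im z : `|complex.Im z|%:C%C <= `|z|.
Proof.
have := normc_ge_Re (z * 'i%C).
by rewrite ReiNIm normrN normrM complexiE normCi mulr1.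
Qed.

Lemma normc_le_Re_Im z : `|z| <= (`|complex.Re z| + `|complex.Im z|)%:C%C.
Proof.
rewrite [z in leLHS]complexE (le_trans (ler_normD _ _))// normrM complexiE normCi mul1r.
by rewrite rmorphD/= !normc_def/= !expr0n/= !addr0 !sqrtr_sqr.
Qed.

Lemma continuous_Re : continuous (@complex.Re R : R[i]^o -> R).
Proof.
move=> z A /nbhs_ballP[e /= e0 eA].
have : nbhs (z : R[i]^o) (ball z e%:C%C) by apply: nbhsx_ballx; rewrite (ltcR 0 e).
apply: (@filterS _ _ (@nbhs_filter R[i]^o z)) => w zw.
apply: eA; rewrite /ball/= -ltcR; apply: le_lt_trans zw; rewrite -raddfB; exact: normc_ge_Re.
Qed.

Lemma continuous_Im : continuous (@complex.Im R : R[i]^o -> R).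
Proof.
move=> z A /nbhs_ballP[e /= e0 eA].
have : nbhs (z : R[i]^o) (ball z e%:C%C) by apply: nbhsx_ballx; rewrite (ltcR 0 e).
apply: (@filterS _ _ (@nbhs_filter R[i]^o z)) => w zw.
apply: eA; rewrite /ball/= -ltcR; apply: le_lt_trans zw; rewrite -raddfB; exact: normc_ge_Im.
Qed.

Lemma cvg_complex (a b : nat -> R) (u v : R) :
  a @ \oo --> u -> b @ \oo --> v ->
  (fun k => Complex (a k) (b k) : R[i]^o) @ \oo --> (Complex u v : R[i]^o).
Proof.
move=> au bv; apply/cvgrPdist_lt => e e0.
(* Positive elements of [R[i]] are real, so [e] comes from a real [r]. *)
have [r eE] : exists r, e = r%:C%C.
  by apply/complex_realP; exact: gtr0_real.
move: e0; rewrite {}eE (ltcR 0 r) => r0.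
have r2 : 0 < r / 2 by rewrite divr_gt0.
move/cvgrPdist_lt : au => /(_ _ r2) au.
move/cvgrPdist_lt : bv => /(_ _ r2) bv.
near=> k; apply: le_lt_trans (normc_le_Re_Im _) _.
rewrite ltcR /= [ltRHS]splitr; apply: ltrD; near: k; [exact: au|exact: bv].
Unshelve. all: by end_near. Qed.

End complex_convergence.

(** * Averages over cylinders *)

Section birkhoff_averages.
Context {R : realType} {D : alphabetType}.
Local Notation X := (full_shift D).

Definition birkhoff_average k (g : X -> R) (y : X) : R :=
  k%:R^-1 * \sum_(i < k) g (iter i left_shift y).

Lemma cylinderE k (x : X) : cylinder k x = [set y | word 0 k y = word 0 k x].
Proof.
apply/seteqP; split => y /=.
  move=> xy; apply: eq_word => j jk.
  have := xy `|j|%N; rewrite /generator /= iter_left_shift add0r.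
  have -> : `|j|%N%:Z = j by lia.
  by apply; lia.
move=> /word_inj xy i /= ik; rewrite /generator/= iter_left_shift add0r.
by apply: xy; lia.
Qed.

Lemma measurable_cylinder k (x : X) : measurable (cylinder k x).
Proof. rewrite cylinderE; exact: (@measurable_word _ 0 k [set word 0 k x]). Qed.

Lemma continuous_birkhoff_average k (g : X -> R) :
  continuous g -> continuous (birkhoff_average k g).
Proof.
move=> cg.
have cgi i : continuous (fun y : X => g (iter i left_shift y)).
  apply/continuousP => A oA.
  have := (continuousP g).1 cg _ oA; exact: ((continuousP _).1 (@continuous_iter_shift D i)).
have cs : continuous (fun y : X => \sum_(i < k) g (iter i left_shift y)).
  by apply: continuous_big => [|i _]; [exact: add_continuous|exact: cgi].
have cZ (h : X -> R) : continuous h -> continuous (fun y => k%:R^-1 * h y).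
  by move=> ch y; exact: (@cvgMl_tmp R _ (nbhs y) (nbhs_filter y) h _ _ (ch y)).
exact: (cZ _ cs).
Qed.

Lemma birkhoff_average_dist k (g h : X -> R) e : 0 <= e ->
  (forall y, `|g y - h y| <= e) ->
  forall y, `|birkhoff_average k g y - birkhoff_average k h y| <= e.
Proof.
move=> e0 gh y; rewrite /birkhoff_average -mulrBr -sumrB normrM ger0_norm//.
have [->|k0] := posnP k; first by rewrite invr0 mul0r.
rewrite mulrC ler_pdivrMr ?ltr0n// (le_trans (ler_norm_sum _ _ _))//.
apply: le_trans (ler_sum _ (fun i _ => gh _)) _.
by rewrite sumr_const card_ord mulr_natr.
Qed.

Lemma sum_lt_le k n : (\sum_(i < k) (i < n)%N <= n)%N.
Proof.
elim: k n => [|k IH] n; first by rewrite big_ord0.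
rewrite big_ord_recl; case: n => [|n] /=; last exact: (IH n).
by rewrite big1.
Qed.

(* For n <= i < k - n, the window of width n around i lies inside [0, k). *)
Lemma birkhoff_average_cylinder (g : X -> R) e : continuous g -> 0 < e ->
  exists N, forall k x y, (N <= k)%N -> cylinder k x y ->
    `|birkhoff_average k g y - birkhoff_average k g x| <= e.
Proof.
move=> cg e0; have e2 : 0 < e / 2 by rewrite divr_gt0.
have [n gn] := continuous_window cg e2.
have [M gM] := continuous_bounded cg.
have M0 : 0 <= M by apply: le_trans (gM point).
(* At most [2 * n] indices are near an end of [[0, k)], each contributing at most [2 * M]; their
   share is at most [e / 2] once [4 * M * n <= k * e / 2]. *)
pose N := (Num.truncn (8 * M * n%:R / e)).+1.
exists N => k x y Nk; rewrite cylinderE /= => /word_inj xy.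
have kN : 8 * M * n%:R / e <= k%:R.
  apply: (@le_trans _ _ N%:R); last by rewrite ler_nat.
  by rewrite ltW// truncnS_gt.
have k0 : 0 < k%:R :> R by rewrite ltr0n; apply: leq_trans Nk.
have term (i : 'I_k) : `|g (iter i left_shift y) - g (iter i left_shift x)| <=
    e / 2 + 2 * M * ((i < n)%N + (k <= i + n)%N)%:R.
  have [iin|iout] := boolP ((n <= i)%N && (i + n < k)%N).
    have Mge0 : 0 <= 2 * M * ((i < n)%N + (k <= i + n)%N)%:R by rewrite !mulr_ge0.
    suff : `|g (iter i left_shift y) - g (iter i left_shift x)| <= e / 2 by lra.
    apply: gn; rewrite /window !word_iter_shift; apply: eq_word => j ?.
    by apply: xy; lia.
  have : 1 <= ((i < n)%N + (k <= i + n)%N)%:R :> R by rewrite ler1n; lia.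
  move: (_%:R : R) => c c1.
  have : 2 * M <= 2 * M * c by rewrite ler_peMr// mulr_ge0.
  have := ler_normB (g (iter i left_shift y)) (g (iter i left_shift x)).
  have := gM (iter i left_shift y); have := gM (iter i left_shift x); lra.
rewrite /birkhoff_average -mulrBr -sumrB normrM ger0_norm ?invr_ge0 ?ler0n//.
rewrite mulrC ler_pdivrMr// (le_trans (ler_norm_sum _ _ _))//.
apply: (le_trans (ler_sum _ (fun i _ => term i))).
rewrite big_split/= sumr_const card_ord -mulr_sumr -natr_sum big_split/=.
have s1 := sum_lt_le k n.
(* Reversing the order of the indices turns the right end into the left end. *)
have s2 : (\sum_(i < k) (k <= i + n)%N <= n)%N.
  rewrite (reindex_inj rev_ord_inj)/=; apply: leq_trans s1.
  by apply: leq_sum => i _; have := ltn_ord i; lia.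
have : (\sum_(i < k) (i < n)%N + \sum_(i < k) (k <= i + n)%N)%:R <= 2 * n%:R :> R.
  by rewrite -natrM ler_nat mul2n -addnn leq_add.
move: (_%:R : R) => c cn.
have : 2 * M * c <= 2 * M * (2 * n%:R) by rewrite ler_wpM2l// mulr_ge0.
rewrite ler_pdivrMr// in kN.
rewrite -[_ *+ k]mulr_natr; nra.
Qed.

Lemma frequencyE a (u : seq D) k (y : X) :
  frequency a u k y = birkhoff_average k (fun z => (word a (size u) z == u)%:R) y.
Proof.
by congr (_ * _); apply: eq_bigr => i _; rewrite word_iter_shift.
Qed.

Lemma alphaE (mu : {measure set X -> \bar R}) F k (f : X -> R[i]) :
  alpha mu F (ergodic_average k f) =
  Complex ((fine (mu F))^-1 * \int[mu]_(y in F) birkhoff_average k (@complex.Re R \o f) y)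
          ((fine (mu F))^-1 * \int[mu]_(y in F) birkhoff_average k (@complex.Im R \o f) y).
Proof.
have ReE (c : R) (z : R[i]) : complex.Re (c%:C%C * z) = c * complex.Re z.
  by case: z => a b /=; rewrite mul0r subr0.
have ImE (c : R) (z : R[i]) : complex.Im (c%:C%C * z) = c * complex.Im z.
  by case: z => a b /=; rewrite mul0r addr0.
have kE : (k%:R^-1 : R[i]) = (k%:R^-1)%:C%C by rewrite fmorphV rmorph_nat.
apply/eqP; rewrite eq_complex /alpha ReE ImE /=; apply/andP; split; apply/eqP;
  congr (_ * _); apply: eq_Rintegral => y _; rewrite /ergodic_average kE.
- by rewrite ReE raddf_sum.
- by rewrite ImE raddf_sum.
Qed.

Variable mu : probability X R.

(** By [birkhoff_average_cylinder] the two sequences differ by something that tends to 0; the bound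
    there is uniform in the point, so [x k] may change with [k]. Both directions serve to identify
    two sets of sequences. *)
Lemma mean_birkhoff_average (g : X -> R) (x : nat -> X) (l : R) : continuous g ->
  (forall k, (0 < mu (cylinder k.+1 (x k)))%E) ->
  (fun k => (fine (mu (cylinder k.+1 (x k))))^-1 *
     \int[mu]_(y in cylinder k.+1 (x k)) birkhoff_average k.+1 g y) @ \oo --> l <->
  (fun k => birkhoff_average k.+1 g (x k)) @ \oo --> l.
Proof.
move=> cg x0.
set u := (fun k => _ * _); set v := (fun k => birkhoff_average _ _ _).
have uv : (fun k => u k - v k) @ \oo --> (0 : R).
  apply/cvgrPdist_le => e e0; have [N NP] := birkhoff_average_cylinder cg e0.
  exists N => // k /= Nk; rewrite sub0r normrN.
  apply: mean_near => //; first exact: measurable_cylinder.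
    exact: continuous_birkhoff_average.
  by move=> y; apply: NP; apply: leqW.
split=> [ul|vl].
  rewrite -[l]subr0 (_ : v = u - (fun k => u k - v k)); first exact: cvgB.
  by apply/funext => k; rewrite !fctE; ring.
rewrite -[l]addr0 (_ : u = v + (fun k => u k - v k)); first exact: cvgD.
by apply/funext => k; rewrite !fctE; ring.
Qed.

End birkhoff_averages.

(** * Generic sequences *)

Section good_set.
Context {R : realType} {D : alphabetType} (p : D -> R).
Local Notation X := (full_shift D).
Hypothesis p_prob : probability_vector p.
Variable mu : probability X R.
Hypothesis mu_bernoulli : is_bernoulli_measure p mu.

Lemma word_expectation_eq (u : seq D) :
  word_expectation p (size u) (fun s => (s == u)%:R) = \prod_(d <- u) p d.
Proof.
elim: u => [|d u IH] /=; first by rewrite big_nil.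
rewrite big_cons (bigD1 d)//= [X in _ + X]big1 ?addr0 => [|c /negbTE cd].
  congr (_ * _); rewrite -IH; apply: (eq_word_expectation p_prob.1) => s _.
  by rewrite eqseq_cons eqxx.
rewrite (eq_word_expectation p_prob.1 (G := fun=> 0)) => [|s _].
  by rewrite (word_expectation_cst p_prob.2) mulr0.
by rewrite eqseq_cons cd.
Qed.

Lemma mu_word_eq a (u : seq D) :
  mu [set y | word a (size u) y == u] = (\prod_(d <- u) p d)%:E.
Proof. by rewrite (mu_word mu_bernoulli a (size u) (pred1 u)) word_expectation_eq. Qed.

Lemma mu_cylinder k (x : X) : mu (cylinder k x) = (\prod_(d <- word 0 k x) p d)%:E.
Proof.
rewrite -(mu_word_eq 0) size_word cylinderE; congr (mu _).
by apply/seteqP; split => y /= /eqP.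
Qed.

Lemma Rintegral_word_eq a (u : seq D) :
  \int[mu]_y (word a (size u) y == u)%:R = \prod_(d <- u) p d.
Proof.
pose A := [set y : X | word a (size u) y == u].
have mA : measurable A by exact: (@measurable_word _ a (size u) [set s | s == u]).
rewrite -[RHS]/(fine (_)%:E) -(mu_word_eq a) -/A -[in RHS](setIT A).
rewrite -integral_indic//; congr fine; apply: eq_integral => y _.
by rewrite indicE; congr ((_ : bool)%:R%:E); apply/idP/idP => [wu|/set_mem//]; exact/mem_set.
Qed.

(** Here the sequence is fixed: [g] is uniformly close to a finite combination [h] of word
    indicators, for which the claim is the convergence of frequencies. *)
Lemma birkhoff_average_cvg (x : nat -> X) (g : X -> R) :
  (forall a u, (fun k => frequency a u k.+1 (x k)) @ \oo --> \prod_(d <- u) p d) ->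
  continuous g ->
  (fun k => birkhoff_average k.+1 g (x k)) @ \oo --> \int[mu]_y g y.
Proof.
move=> freq cg; apply/cvgrPdist_le => e e0.
(* Three errors: [g] against [h] in the average, [g] against [h] in the integral, and the
   convergence for [h]. *)
have e3 : 0 < e / 3 by rewrite divr_gt0.
have [n gn] := continuous_window cg e3.
(* The value of [g] at some point with window [u]; the default [point] would serve only words that
   are no window. *)
pose c (u : seq D) := g (xget point [set y | window n y = u]).
pose T := (n + n.+1).-tuple D.
pose h y := \sum_(u : T) c u * (word (- n%:Z) (size u) y == u)%:R.
have hE y : h y = c (window n y).
  have sw : size (window n y) == (n + n.+1)%N by rewrite size_word.
  rewrite /h (bigD1 (Tuple sw))//= size_word eqxx mulr1 big1 ?addr0// => u.
  rewrite size_tuple => /eqP uw; case: eqP => [yu|]; last by rewrite mulr0.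
  by exfalso; apply: uw; apply: val_inj; rewrite /= -yu.
have gh y : `|g y - h y| <= e / 3.
  rewrite hE /c; apply: gn.
  by case: xgetP => [z _ /= ->//|/(_ y)]; case.
have ci a u : continuous (fun y : X => (word a (size u) y == u)%:R : R).
  exact: (@continuous_word D R a (size u) (fun s => (s == u)%:R)).
have cci (u : T) : continuous (fun y : X => c u * (word (- n%:Z) (size u) y == u)%:R : R).
  exact: (@continuous_word D R _ (size u) (fun s => c u * (s == u :> seq D)%:R)).
have ch : continuous h.
  by apply: continuous_big => [|u _]; [exact: add_continuous|exact: cci].
have hint : \int[mu]_y h y = \sum_(u : T) c u * \prod_(d <- u) p d.
  rewrite /h Rintegral_sum//; apply: eq_bigr => u _.
  rewrite RintegralZl// ?Rintegral_word_eq//.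
  exact: continuous_integrable.
have hcvg : (fun k => birkhoff_average k.+1 h (x k)) @ \oo --> \int[mu]_y h y.
  rewrite hint (_ : (fun k => _) =
      fun k => \sum_(u : T) c u * frequency (- n%:Z) u k.+1 (x k)).
    apply: cvg_big => [|u _]; first exact: add_continuous.
    by apply: cvgMl_tmp; exact: freq.
  apply/funext => k; rewrite /birkhoff_average /h exchange_big/= mulr_sumr.
  apply: eq_bigr => u _; rewrite frequencyE /birkhoff_average -mulr_sumr mulrCA.
  by [].
have mu1 : fine (mu setT) = 1 by rewrite probability_setT.
have inth : `|\int[mu]_y g y - \int[mu]_y h y| <= e / 3.
  have cgh : continuous (fun y => g y - h y).
    by move=> y; exact: (@cvgB _ _ _ (nbhs y) (nbhs_filter y) g h _ _ (cg y) (ch y)).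
  rewrite -RintegralB//; [|exact: continuous_integrable|exact: continuous_integrable].
  have := @mean_near _ _ mu (fun y => g y - h y) setT 0 (e / 3).
  rewrite mu1 invr1 mul1r subr0; apply => //.
    by rewrite probability_setT lte01.
  by move=> y _; rewrite subr0.
move/cvgrPdist_le : hcvg => /(_ _ e3); apply: filterS => k hk.
have := birkhoff_average_dist k.+1 (ltW e3) gh (x k).
move: hk inth; rewrite !ler_norml => /andP[? ?] /andP[? ?] /andP[? ?].
by apply/andP; split; lra.
Qed.

End good_set.

(** Testing only the tolerances [1 / (m + 1)] makes convergence a countable combination of
    measurable conditions. *)
Lemma measurable_cvg_to (R : realType) d (T : measurableType d) (h : nat -> T -> R) (c : R) :
  (forall k (e : R), measurable [set x | `|c - h k x| < e]) ->
  measurable [set x | (fun k => h k x) @ \oo --> c].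
Proof.
move=> mh.
rewrite (_ : mkset _ = \bigcap_m \bigcup_N \bigcap_(k in [set k | (N <= k)%N])
    [set x | `|c - h k x| < m.+1%:R^-1]).
  apply: bigcapT_measurable => m; apply: bigcupT_measurable => N.
  by apply: bigcap_measurable => //; exists N; rewrite /=.
apply/seteqP; split => x /=.
  move=> hc m _; have /cvgrPdist_lt := hc.
  move=> /(_ m.+1%:R^-1); rewrite invr_gt0 => /(_ (ltr0Sn _ _)) [N _ hN].
  by exists N => // k /= /hN.
move=> H; apply/cvgrPdist_lt => e e0.
have [m _ me] := near_infty_natSinv_lt (PosNum e0).
have [N _ hN] := H m I.
exists N => // k /= Nk; apply: lt_trans (me m (leqnn m)).
exact: hN.
Qed.

(** * Measurability and full measure of the generic sequences *)

Section full_measure.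
Context {R : realType} {D : alphabetType} (p : D -> R).
Local Notation X := (full_shift D).
Hypothesis p_prob : probability_vector p.
Variable mu : probability X R.
Hypothesis mu_bernoulli : is_bernoulli_measure p mu.
Variable P : probability (countable_power X) R.
Hypothesis P_product : is_product_measure (@measurable _ X) mu P.

Lemma mu_cylinder_gt0E k (x : X) :
  (0 < mu (cylinder k x))%E = (0 < \prod_(d <- word 0 k x) p d).
Proof. by rewrite (mu_cylinder p_prob mu_bernoulli) lte_fin. Qed.

(** The set of the theorem, described by countably many conditions: one for each [k] and one for
    each pair of an offset and a word. Measurability and full measure can thus be checked one
    condition at a time. *)
Definition generic_sequences : set (countable_power X) :=
  [set x | (forall k : nat, (0 < mu (cylinder k.+1 (x k)))%E) /\
    forall a u, (fun k => frequency a u k.+1 (x k)) @ \oo --> \prod_(d <- u) p d].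

(** This exhibits the frequency as a function of one finite word, the form in which
    [measurable_word] applies. *)
Lemma frequency_word a (u : seq D) k (y : X) :
  frequency a u k y = k%:R^-1 * \sum_(i < k)
    (take (size u) (drop i (word a (k + size u) y)) == u)%:R :> R.
Proof.
congr (_ * _); apply: eq_bigr => i _.
have -> : (k + size u = i + (size u + (k - i)))%N by have := ltn_ord i; lia.
by rewrite word_cat drop_size_cat ?size_word// word_cat take_size_cat ?size_word.
Qed.

Lemma measurable_mu_cylinder_gt0 k :
  measurable [set x : countable_power X | (0 < mu (cylinder k.+1 (x k)))%E].
Proof.
apply: (measurable_coordinate k (B := [set y | (0 < mu (cylinder k.+1 y))%E])).
rewrite (_ : mkset _ = [set y | 0 < \prod_(d <- word 0 k.+1 y) p d]).
  exact: (@measurable_word _ 0 k.+1 [set s | 0 < \prod_(d <- s) p d]).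
by apply/seteqP; split => y /=; rewrite mu_cylinder_gt0E.
Qed.

Lemma measurable_frequency_cvg a u : measurable [set x : countable_power X |
  (fun k => frequency a u k.+1 (x k)) @ \oo --> \prod_(d <- u) p d].
Proof.
apply: (@measurable_cvg_to _ _ _ (fun k (x : countable_power X) => frequency a u k.+1 (x k))).
move=> k e; apply: (measurable_coordinate k
  (B := [set y | `|\prod_(d <- u) p d - frequency a u k.+1 y| < e])).
under eq_set do rewrite frequency_word.
exact: (@measurable_word _ a (k.+1 + size u) [set s | `|\prod_(d <- u) p d -
  k.+1%:R^-1 * \sum_(i < k.+1) (take (size u) (drop i s) == u)%:R| < e]).
Qed.

(** Enumerates all offsets and words by their codes; numbers that code nothing impose no
    condition. *)
Definition cvg_frequencies (n : nat) : set (countable_power X) :=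
  if (choice.unpickle n : option (int * seq D)) is Some au then
    [set x | (fun k => frequency au.1 au.2 k.+1 (x k)) @ \oo -->
      \prod_(d <- au.2) p d]
  else setT.

Lemma generic_sequencesE : generic_sequences =
  \bigcap_k [set x | (0 < mu (cylinder k.+1 (x k)))%E] `&`
  \bigcap_n cvg_frequencies n.
Proof.
apply/seteqP; split => x /=.
  move=> [x0 xf]; split=> [k _|n _]; first exact: x0.
  by rewrite /cvg_frequencies; case: choice.unpickle => // -[a u]; exact: xf.
move=> [x0 xf]; split=> [k|a u]; first exact: x0.
by have := xf (choice.pickle (a, u)) I; rewrite /cvg_frequencies choice.pickleK.
Qed.

Lemma measurable_generic_sequences : measurable generic_sequences.
Proof.
rewrite generic_sequencesE; apply: measurableI; apply: bigcapT_measurable => k.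
  exact: measurable_mu_cylinder_gt0.
by rewrite /cvg_frequencies; case: choice.unpickle => [[a u]|];
  [exact: measurable_frequency_cvg|exact: measurableT].
Qed.

(** A cylinder is null exactly when its word contains a letter of probability 0, and this has
    probability 0 for the point [x k]. *)
Lemma ae_mu_cylinder_gt0 k : {ae P, forall x, (0 < mu (cylinder k.+1 (x k)))%E}.
Proof.
have [p0 p1] := p_prob.
exists (~` [set x : countable_power X | (0 < mu (cylinder k.+1 (x k)))%E]); split => //.
  by apply: measurableC; exact: measurable_mu_cylinder_gt0.
(* The factor 1 is the [q] of [word_expectation_null]. *)
pose B := [set y : X | 1 * \prod_(d <- word 0 k.+1 y) p d == 0].
rewrite (_ : ~` _ = [set x : countable_power X | B (x k)]); last first.
  apply/seteqP; split => x /=; rewrite /B/= mul1r mu_cylinder_gt0E lt0r prodr_ge0// andbT.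
  - by move=> /negP; rewrite negbK.
  - by move=> /eqP ->; rewrite eqxx.
rewrite (coordinate_measure P_product).
  rewrite (mu_word mu_bernoulli 0 k.+1 (fun s => 1 * \prod_(d <- s) p d == 0)).
  by rewrite (word_expectation_null p0 p1) oner_eq0.
exact: (@measurable_word _ 0 k.+1 [set s | 1 * \prod_(d <- s) p d == 0]).
Qed.

Lemma generic_sequences_measure1 : P generic_sequences = 1%E.
Proof.
have aeF := ae_filter_ringOfSetsType P.
have : {ae P, forall x, generic_sequences x}.
  rewrite generic_sequencesE; apply: (@filterI _ (almost_everywhere P) aeF).
    have : {ae P, forall x, forall k, (0 < mu (cylinder k.+1 (x k)))%E}.
      by apply: ae_foralln => k; exact: ae_mu_cylinder_gt0.
    by apply: (@filterS _ (almost_everywhere P) aeF) => x x0 k _; exact: x0.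
  have : {ae P, forall x, forall n, cvg_frequencies n x}.
    apply: ae_foralln => n; rewrite /cvg_frequencies; case: choice.unpickle => [[a u]|];
      last exact: aeW.
    exact: (frequency_ae_cvg p_prob mu_bernoulli P_product).
  by apply: (@filterS _ (almost_everywhere P) aeF) => x xG n _; exact: xG.
move=> /(measure_negligible (measurableC measurable_generic_sequences)).
move=> PC0; have := probability_setC P (measurableC measurable_generic_sequences).
by rewrite setCK => ->; rewrite PC0 sube0.
Qed.

End full_measure.

(* A sequence (x_k) with k >= 1 is encoded as x : nat -> X, with x k standing
   for the (k+1)-st term. Membership in the set includes that all the averages
   alpha are defined, i.e. that no cylinder involved is a null set. *)
Theorem theorem4p3 (R : realType) (D : alphabetType) (p : D -> R)
    (p_prob : probability_vector p)
    (mu : probability (full_shift D) R)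
    (mu_bernoulli : is_bernoulli_measure p mu)
    (muoo : probability (countable_power (full_shift D)) R)
    (muoo_product : is_product_measure (@measurable _ (full_shift D)) mu muoo) :
  let S : set (countable_power (full_shift D)) :=
    [set x | (forall k : nat, (0 < mu (cylinder k.+1 (x k)))%E) /\
             (forall f : full_shift D -> R[i]^o, continuous f ->
                (fun k : nat => alpha mu (cylinder k.+1 (x k))
                                  (ergodic_average k.+1 f) : R[i]^o)
                  @ \oo --> (complex_integral mu setT f : R[i]^o))] in
  measurable S /\ muoo S = 1%E.
Proof.
(* Equality of the two sets yields the measurability of [S] along with its measure. *)
move=> S; suff -> : S = generic_sequences p mu.
  split; first exact: (measurable_generic_sequences p_prob mu_bernoulli).
  exact: (generic_sequences_measure1 p_prob mu_bernoulli muoo_product).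
apply/seteqP; split => x [x0 xS]; split => //.
  (* Word indicators are continuous, so they are admissible test functions; the real parts of their
     averages give back the frequencies. *)
  move=> a u; pose g (y : full_shift D) : R := (word a (size u) y == u)%:R.
  have cg : continuous g.
    exact: (@continuous_word D R a (size u) (fun s => (s == u)%:R)).
  pose f (y : full_shift D) : R[i]^o := (g y)%:C%C.
  have cf : continuous f.
    exact: (@continuous_word D R[i]^o a (size u) (fun s => ((s == u)%:R : R)%:C%C)).
  have Refx := continuous_cvg _ (@continuous_Re R _) (xS f cf).
  under eq_fun do rewrite frequencyE.
  apply/(mean_birkhoff_average _ cg x0).
  rewrite -(Rintegral_word_eq p_prob mu_bernoulli a u).
  rewrite (_ : (fun k => _) = fun k => complex.Re (alpha mu (cylinder k.+1 (x k))
      (ergodic_average k.+1 f))); first exact: Refx.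
  by apply/funext => k; rewrite alphaE.
(* Conversely, the frequencies determine the limits for real continuous functions, here the real and
   imaginary parts of [f]. *)
move=> f cf; under eq_fun do rewrite alphaE.
have cRe : continuous (@complex.Re R \o f).
  apply/continuousP => A oA.
  exact: ((continuousP f).1 cf _ ((continuousP _).1 (@continuous_Re R) _ oA)).
have cIm : continuous (@complex.Im R \o f).
  apply/continuousP => A oA.
  exact: ((continuousP f).1 cf _ ((continuousP _).1 (@continuous_Im R) _ oA)).
apply: cvg_complex; apply/(mean_birkhoff_average _ _ x0) => //;
  exact: (birkhoff_average_cvg p_prob mu_bernoulli).
Qed.
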